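(* Consider an execution of Algorithm 3 (see context), with at most $f$ crash failures, on a directed graph $G(\mathcal V,\mathcal E)$ with $n$ agents. Suppose that every reduced graph (under crash faults) of $G(\mathcal V,\mathcal E)$ contains a unique non-trivial weakly-connected component, and that the subgraph induced by this weakly-connected component contains a source. Let $\zeta=\frac{1}{d_{\max}+1}$ with $d_{\max}=\max_{j\in\mathcal V}d_j^-$. Then for every integer $k\ge1$ with $k\ge f$, $$\delta_{(k-1)n+1}\big(\mathbf\Psi(kn,1)\big)\le(1-\zeta^n)^{k-f}.$$
   Context: A synchronous system of $n$ agents $\mathcal V=\{1,\dots,n\}$ communicates over a directed graph $G(\mathcal V,\mathcal E)$ without self-loops; $N_i^-=\{j:(j,i)\in\mathcal E\}$, $d_i^-=|N_i^-|$. $\mathcal F$, with $|\mathcal F|\le f$, is the set of faulty agents, which may crash (stop participating) at some point. $\mathcal N[t]$ is the set of agents that have not crashed by the beginning of iteration $t\ge1$, and $\bar{\mathcal N}[t]=\mathcal N[t+1]\subseteq\mathcal N[t]$ is the set of agents that have not crashed by the end of iteration $t$; $\mathcal N[1]=\mathcal V$. An agent that crashes after performing its update in iteration $t$ is regarded as crashing in iteration $t+1$. Reduced graph under crash faults: a subgraph of $G(\mathcal V,\mathcal E)$, with the same vertex set $\mathcal V$, obtained by removing all the edges incident to up to $|\mathcal F|$ nodes in $\mathcal F$. Source of a directed graph: the collection of its nodes each of which has a directed path to every other node of that graph; the graph contains a source if this collection is non-empty. A weakly-connected component is non-trivial if it has more than one node. **Algorithm 3.** In iteration $t\ge1$ each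 agent $i\in\mathcal N[t]$ sends its state $x_i[t-1]$ on all outgoing edges, receives values on incoming edges from a set $\mathcal R_i(t)\subseteq N_i^-$ of agents, with $\ell_i(t)=|\mathcal R_i(t)|$, and updates $x_i[t]=\frac1{\ell_i(t)+1}\sum_{j\in\mathcal R_i(t)\cup\{i\}}x_j[t-1]$. Links are reliable and values can be received only from agents that have not crashed by the beginning of the iteration, so $N_i^-\cap\bar{\mathcal N}[t]\subseteq\mathcal R_i(t)\subseteq N_i^-\cap\mathcal N[t]$. For $i\notin\bar{\mathcal N}[t]$, $x_i[t]=x_i[t-1]$. **Matrices.** $\mathbf P[t]\in\mathbb R^{n\times n}$: for $i\in\bar{\mathcal N}[t]$, $\mathbf P_{ij}[t]=\frac1{\ell_i(t)+1}$ if $j\in\mathcal R_i(t)\cup\{i\}$ and $0$ otherwise; for $i\notin\bar{\mathcal N}[t]$, $\mathbf P_{ii}[t]=1$ and $\mathbf P_{ij}[t]=0$ for $j\ne i$. Thus $\mathbf x[t]=\mathbf P[t]\mathbf x[t-1]$. $\mathbf\Psi(t,r)=\mathbf P[t]\mathbf P[t-1]\cdots\mathbf P[r]$ for $t\ge r\ge1$. For $r\ge1$ and such a product $\mathbf\Psi(t',t)$: $\delta_r(\mathbf\Psi(t',t))=\max_{\beta\in\mathcal N[r]}\max_{\alpha,\alpha'\in\mathcal N[r]}|\mathbf\Psi_{\alpha\beta}(t',t)-\mathbf\Psi_{\alpha'\beta}(t',t)|$.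
   Formalization: The formal theorem additionally assumes that in every reduced graph all nodes whose edges were not removed lie in the non-trivial weakly-connected component; without this an isolated live agent (e.g. edges 1↔2, agent 3 isolated, no faults, k=1) makes the claim false. *)

(* Defs.v *)
From HB Require Import structures.
From mathcomp Require Import all_boot all_order all_algebra.

Set Implicit Arguments.
Unset Strict Implicit.
Unset Printing Implicit Defensive.

Import Order.TTheory GRing.Theory Num.Theory.
Local Open Scope ring_scope.

Section Digraph.
Variables (T : finType) (E : rel T).

(* [E j i] is the edge from j to i. *)
Definition in_nbr (i : T) : {set T} := [set j | E j i].

(* The reduced graph obtained by removing every edge incident to a node of S;
   the vertex set is unchanged. *)
Definition reduced_graph (S : {set T}) : rel T :=
  [rel u v | [&& E u v, u \notin S & v \notin S]].

Definition weak_adj : rel T := [rel u v | E u v || E v u].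

(* A weakly-connected component, as a set of nodes, with more than one node. *)
Definition nontrivial_wcc (C : {set T}) : Prop :=
  C \in equivalence_partition (connect weak_adj) [set: T] /\ (1 < #|C|)%N.

Definition induced (C : {set T}) : rel T :=
  [rel u v | [&& E u v, u \in C & v \in C]].

(* The source of the subgraph induced by C (so paths stay inside C);
   [connect] is reflexive, which matches "to every other node". *)
Definition source (C : {set T}) : {set T} :=
  [set s in C | [forall v in C, connect (induced C) s v]].

End Digraph.

(* In every reduced graph, the nodes whose edges were not removed all lie in the
   non-trivial weakly-connected component, i.e. the trivial components are
   exactly the removed nodes.  Uniqueness of the non-trivial component alone
   leaves room for a live node with no edge: for 1 <-> 2 with 3 isolated and
   no faulty agent, agent 3 never agrees with 1 and 2. *)
Definition trivial_only_removed (T : finType) (E : rel T) (F : {set T}) : Prop :=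
  forall S C : {set T}, S \subset F ->
    nontrivial_wcc (reduced_graph E S) C -> ~: S \subset C.

Section Algorithm.
Variables (R : realFieldType) (n : nat) (E : rel 'I_n).
(* [N t] is the set of agents not crashed by the beginning of iteration t, hence
   [N t.+1] the set of those not crashed by its end; [rcv t i] is the set of
   agents whose value i receives in iteration t.  Iterations start at 1, so
   the values at t = 0 are irrelevant. *)
Variables (N : nat -> {set 'I_n}) (rcv : nat -> 'I_n -> {set 'I_n}).

Record execution (F : {set 'I_n}) (x : nat -> 'cV[R]_n) : Prop := Execution {
  exec_init : N 1 = [set: 'I_n];
  exec_crash : forall t, (1 <= t)%N -> N t.+1 \subset N t;
  exec_faulty : forall t, (1 <= t)%N -> ~: N t \subset F;
  exec_rcv_sup : forall t i, (1 <= t)%N -> i \in N t ->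
    in_nbr E i :&: N t.+1 \subset rcv t i;
  exec_rcv_sub : forall t i, (1 <= t)%N -> i \in N t ->
    rcv t i \subset in_nbr E i :&: N t;
  exec_update : forall t i, (1 <= t)%N -> i \in N t.+1 ->
    x t i 0 = (#|rcv t i| + 1)%:R^-1 * \sum_(j in rcv t i :|: [set i]) x t.-1 j 0;
  exec_frozen : forall t i, (1 <= t)%N -> i \notin N t.+1 ->
    x t i 0 = x t.-1 i 0
}.

Definition P (t : nat) : 'M[R]_n :=
  \matrix_(i, j)
    if i \in N t.+1 then
      if j \in rcv t i :|: [set i] then (#|rcv t i| + 1)%:R^-1 else 0
    else (i == j)%:R.

(* P t *m P t.-1 *m ... *m P r *)
Definition Psi (t r : nat) : 'M[R]_n :=
  \big[mulmx/1%:M]_(0 <= s < t.+1 - r) P (t - s).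

(* The default value 0 of the maxima is harmless: the terms are nonnegative. *)
Definition delta (r : nat) (A : 'M[R]_n) : R :=
  \big[Num.max/0]_(b in N r)
    \big[Num.max/0]_(a in N r) \big[Num.max/0]_(a' in N r) `|A a b - A a' b|.

Definition dmax : nat := \max_(j < n) #|in_nbr E j|.

Definition zeta : R := (dmax + 1)%:R^-1.

End Algorithm.

(* Main.v *)
Require Import Defs.
From HB Require Import structures.
From mathcomp Require Import all_boot all_order all_algebra.
From mathcomp Require Import lra zify.

Set Implicit Arguments.
Unset Strict Implicit.
Unset Printing Implicit Defensive.

Import Order.TTheory GRing.Theory Num.Theory.
Local Open Scope ring_scope.

(** Each column of [Psi t 1] is a run of the averaging iteration, so it
    suffices to control the range of values of a run on the live agents. Cut
    time into phases of n iterations. Agents alive at the start of a phase only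
    average values of such agents, so their range never widens. In a phase
    without crash, the source of the current reduced graph reaches every live
    agent by a path of length < n, so its value v enters every final value with
    weight at least zeta^n: the range [m, M] shrinks to
    [m + zeta^n (v - m), M - zeta^n (M - v)], a factor 1 - zeta^n. Each other
    phase increases the number of crashed agents, which is at most f. *)

(** All excesses over [m] are nonnegative, so the mean excess is at least the share contributed by
    [j] alone. *)
Lemma mean_ge (R : realFieldType) (I : finType) (S : {set I}) (g : I -> R)
    (m : R) (j : I) : j \in S -> {in S, forall i, m <= g i} ->
  m + #|S|%:R^-1 * (g j - m) <= #|S|%:R^-1 * \sum_(i in S) g i.
Proof.
move=> jS g_ge; have S_gt0 : 0 < #|S|%:R :> R.
  by rewrite ltr0n; apply/card_gt0P; exists j.
have -> : \sum_(i in S) g i = m *+ #|S| + \sum_(i in S) (g i - m).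
  by rewrite sumrB sumr_const addrC subrK.
rewrite [leRHS]mulrDr -[m *+ _]mulr_natl mulKf ?gt_eqF // lerD2l.
rewrite ler_pM2l ?invr_gt0 // (bigD1 j) //= lerDl.
by apply: sumr_ge0 => i /andP[iS _]; rewrite subr_ge0 g_ge.
Qed.

Lemma reduced_graphC (T : finType) (E : rel T) (A : {set T}) u v :
  reduced_graph E (~: A) u v = [&& E u v, u \in A & v \in A].
Proof. by rewrite /reduced_graph /= !inE !negbK. Qed.

(** * Runs of the averaging iteration *)

Section Run.

Variables (R : realFieldType) (n : nat) (E : rel 'I_n).
Variables (N : nat -> {set 'I_n}) (rcv : nat -> 'I_n -> {set 'I_n}).
Variables (F : {set 'I_n}) (x : nat -> 'cV[R]_n).
Hypotheses (no_loop : irreflexive E) (exec : execution E N rcv F x).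

Local Notation zeta := (zeta R E).

(** Not tied to the state [x], so that columns of [Psi] and negated runs are covered. *)
Definition run (y : nat -> 'cV[R]_n) : Prop :=
  forall t, y t.+1 = P R N rcv t.+1 *m y t.

(** Gives upper bounds from lower ones, so only lower bounds need a direct proof. *)
Lemma run_opp y : run y -> run (fun t => - y t).
Proof. by move=> yrun t; rewrite yrun mulmxN. Qed.

Lemma run_col_Psi b : run (fun t => col b (Psi R N rcv t 1)).
Proof.
move=> t; rewrite !colE mulmxA; congr (_ *m _).
by rewrite /Psi !subSS !subn0 big_nat_recl // subn0.
Qed.

Lemma runE y t i : run y ->
  y t.+1 i 0 = if i \in N t.+2
    then (#|rcv t.+1 i| + 1)%:R^-1 * \sum_(j in rcv t.+1 i :|: [set i]) y t j 0
    else y t i 0.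
Proof.
move=> ->; rewrite mxE; under eq_bigr do rewrite mxE.
case: ifP => _.
  rewrite mulr_sumr [RHS]big_mkcond; apply: eq_bigr => j _.
  by case: ifP; rewrite ?mul0r.
rewrite (bigD1 i) //= eqxx mul1r big1 ?addr0 // => j.
by rewrite eq_sym => /negPf->; rewrite mul0r.
Qed.

Lemma zeta_gt0 : 0 < zeta.
Proof. by rewrite invr_gt0 ltr0n addn1. Qed.

Lemma zetaX_le1 m : zeta ^+ m <= 1.
Proof.
apply: exprn_ile1; first exact: ltW zeta_gt0.
by rewrite invf_le1 ?ltr0n ?ler1n addn1.
Qed.

Lemma live_anti t u : (t <= u)%N -> N u.+1 \subset N t.+1.
Proof.
elim: u => [|u IHu]; first by rewrite leqn0 => /eqP->.
rewrite leq_eqVlt ltnS => /predU1P[-> //|/IHu]; apply: subset_trans.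
exact: exec_crash exec _ _.
Qed.

Lemma rcv_live t i j : i \in N t.+2 -> j \in rcv t.+1 i :|: [set i] ->
  j \in N t.+1.
Proof.
move=> iN2; have iN : i \in N t.+1 := subsetP (live_anti (leqnSn t)) i iN2.
rewrite inE => /orP[|/set1P-> //].
by move/(subsetP (exec_rcv_sub exec (ltn0Sn t) iN)); rewrite inE => /andP[].
Qed.

(** Without self-loops [i] is not in [rcv t.+1 i], so the update is a true mean. *)
Lemma card_rcvU t i : i \in N t.+2 ->
  (#|rcv t.+1 i :|: [set i]| = #|rcv t.+1 i| + 1)%N.
Proof.
move=> iN2; have iN : i \in N t.+1 := subsetP (live_anti (leqnSn t)) i iN2.
rewrite setUC cardsU1 addnC; case: (boolP (i \in _)) => //.
move/(subsetP (exec_rcv_sub exec (ltn0Sn t) iN)).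
by rewrite !inE no_loop.
Qed.

Lemma zeta_le t i : i \in N t.+2 ->
  zeta <= #|rcv t.+1 i :|: [set i]|%:R^-1.
Proof.
move=> iN2; have iN : i \in N t.+1 := subsetP (live_anti (leqnSn t)) i iN2.
rewrite card_rcvU // lef_pV2 ?posrE ?ltr0n ?addn1 // ler_nat ltnS.
apply: leq_trans (leq_bigmax i); apply: subset_leq_card.
by apply: subset_trans (exec_rcv_sub exec (ltn0Sn t) iN) (subsetIl _ _).
Qed.

(** * Lower bounds along a run *)

Lemma run_step_ge y t i j m : run y -> i \in N t.+2 ->
    j \in rcv t.+1 i :|: [set i] -> {in N t.+1, forall l, m <= y t l 0} ->
  m + zeta * (y t j 0 - m) <= y t.+1 i 0.
Proof.
move=> yrun iN2 ji y_ge; rewrite runE // iN2 -card_rcvU //.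
apply: le_trans (mean_ge ji _) => [|l li]; last exact/y_ge/(rcv_live iN2).
(* The weight may be lowered to [zeta] because the excess over [m] is nonnegative. *)
rewrite lerD2l ler_wpM2r ?zeta_le // subr_ge0.
exact/y_ge/(rcv_live iN2).
Qed.

(** Agents that crash meanwhile are included, since their values freeze; [delta] ranges over such
    agents too. *)
Lemma run_ge y t m u : run y -> {in N t.+1, forall i, m <= y t i 0} ->
  {in N t.+1, forall i, m <= y (t + u)%N i 0}.
Proof.
move=> yrun y_ge; elim: u => [|u IHu] i iN; first by rewrite addn0 y_ge.
rewrite addnS; case: (boolP (i \in N (t + u).+2)) => [iN2|/negPf iN2].
  have sub := subsetP (live_anti (leq_addr u t)).
  have := run_step_ge (j := i) yrun iN2 _ (fun l lN => IHu l (sub l lN)).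
  rewrite !inE eqxx orbT => /(_ isT); apply: le_trans.
  by rewrite lerDl mulr_ge0 ?(ltW zeta_gt0) // subr_ge0 IHu.
by rewrite runE // iN2 IHu.
Qed.

(** Each iteration costs one factor [zeta]. Peeling the path from its end lets a short path wait at
    [s], through the self-weight. *)
Lemma run_path_ge y t m T s p u : run y ->
    {in N t.+1, forall i, m <= y t i 0} -> N (t + T).+1 = N t.+1 ->
    s \in N t.+1 -> path (reduced_graph E (~: N t.+1)) s p ->
    (size p <= u <= T)%N ->
  m + zeta ^+ u * (y t s 0 - m) <= y (t + u)%N (last s p) 0.
Proof.
move=> yrun y_ge NT sN; elim: u p => [|u IHu] p sp /andP[pu uT].
  by move: pu; rewrite leqn0 => /nilP->; rewrite addn0 mul1r addrC subrK.
have live v : (v <= T)%N -> N (t + v).+1 = N t.+1.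
  move=> vT; apply/eqP; rewrite eqEsubset live_anti ?leq_addr //= -NT.
  by rewrite live_anti // leq_add2l.
(* [j] precedes the endpoint on the path, or is [s] itself if the path is empty. *)
have [j jp ji] : exists2 j, m + zeta ^+ u * (y t s 0 - m) <= y (t + u)%N j 0
    & last s p \in N t.+1 /\ j \in rcv (t + u).+1 (last s p) :|: [set last s p].
  case/lastP: p sp pu => [_ _|p z].
    exists s; first by apply: (IHu [::]) => //=; apply: ltnW.
    by rewrite /= sN !inE eqxx orbT.
  rewrite rcons_path size_rcons ltnS last_rcons => /andP[sp].
  rewrite reduced_graphC => /and3P[Ez lN zN] pu.
  exists (last s p); first by apply: IHu; rewrite // pu ltnW.
  split=> //; rewrite inE; apply/orP; left.
  (* Reception is guaranteed only from agents that survive the iteration, hence the need for a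
     crash-free phase. *)
  apply: (subsetP (exec_rcv_sup exec _ _)) => //; first by rewrite live // ltnW.
  by rewrite !inE Ez /= -addnS live.
case: ji => lN ji; rewrite addnS.
have lN2 : last s p \in N (t + u).+2 by rewrite -addnS live.
have := run_step_ge yrun lN2 ji (m := m); rewrite live ?(ltnW uT) // => step.
apply: le_trans (step (run_ge u yrun y_ge)).
rewrite lerD2l exprS -mulrA ler_wpM2l ?(ltW zeta_gt0) //.
by rewrite lerBrDl.
Qed.

(** * Contraction over phases *)

Hypothesis reduced : forall S : {set 'I_n}, S \subset F ->
  exists2 C : {set 'I_n},
    unique (nontrivial_wcc (reduced_graph E S)) C
    & source (reduced_graph E S) C != set0.
Hypothesis removed : trivial_only_removed E F.

(** By [removed] the non-trivial component contains every live agent, so its source reaches them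
    all; paths are shortened to simple ones. *)
Lemma live_root t i : i \in N t.+1 ->
  exists2 s, s \in N t.+1 & {in N t.+1, forall j, exists p,
    [/\ path (reduced_graph E (~: N t.+1)) s p, j = last s p & (size p <= n)%N]}.
Proof.
move=> iN; have SF := exec_faulty exec (ltn0Sn t).
have [C [Cwcc _] /set0Pn[s]] := reduced SF.
have := removed SF Cwcc; rewrite setCK => /subsetP NC.
rewrite inE => /andP[_ /forall_inP sC].
have reach j : j \in N t.+1 -> exists p,
    [/\ path (reduced_graph E (~: N t.+1)) s p, j = last s p & (size p <= n)%N].
  move=> /NC /sC /connectP[q sq ->].
  have sq' : path (reduced_graph E (~: N t.+1)) s q.
    by apply: sub_path sq => a b /and3P[].
  case/shortenP: sq' => p sp Up _; exists p; split=> //.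
  by have := max_card (mem (s :: p)); rewrite (card_uniqP Up) card_ord; apply: ltnW.
(* A path to the live [i] is empty, whence [s = i], or begins with an edge of the reduced graph,
   whose ends are live. *)
exists s => //; have [[|z p]] := reach i iN; first by move=> [_ /= <-].
by rewrite /= reduced_graphC => -[/andP[/and3P[]]].
Qed.

Lemma run_contract y t m M : run y -> N (t + n).+1 = N t.+1 ->
    {in N t.+1, forall i, m <= y t i 0 <= M} ->
  exists m', {in N t.+1, forall i,
    m' <= y (t + n)%N i 0 <= m' + (1 - zeta ^+ n) * (M - m)}.
Proof.
move=> yrun NT y_in.
have [N0|[i iN]] := set_0Vmem (N t.+1); first by exists 0 => i; rewrite N0 inE.
have [s sN root] := live_root iN.
(* The matching upper end is [M - zeta ^+ n * (M - y t s 0)], which the negated run yields. *)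
exists (m + zeta ^+ n * (y t s 0 - m)) => j /root[p [sp -> pn]].
have pn' : (size p <= n <= n)%N by rewrite pn leqnn.
apply/andP; split.
  by apply: run_path_ge NT sN sp pn' => // l /y_in/andP[].
have y_le : {in N t.+1, forall l, - M <= (- y t) l 0}.
  by move=> l /y_in/andP[_ ?]; rewrite mxE lerN2.
have := run_path_ge (run_opp yrun) y_le NT sN sp pn'.
rewrite !mxE; set z := _ ^+ _; lra.
Qed.

(** The exponent, a truncated difference, is a lower bound for the number of crash-free phases, as
    each other phase crashes a new agent. *)
Lemma run_range y m k : run y -> (forall i, m <= y 0%N i 0 <= m + 1) ->
  exists m', {in N (k * n).+1, forall i, m' <= y (k.+1 * n)%N i 0
    <= m' + (1 - zeta ^+ n) ^+ (k.+1 - #|~: N (k.+1 * n).+1|)}.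
Proof.
move=> yrun y0; set q := 1 - _.
have q_ge0 : 0 <= q by rewrite subr_ge0 zetaX_le1.
have q_le1 : q <= 1 by rewrite gerBl exprn_ge0 // ltW ?zeta_gt0.
have anti l : N (l.+1 * n).+1 \subset N (l * n).+1.
  by apply: live_anti; rewrite leq_mul2r leqnSn orbT.
have phase l : (exists m', {in N (l * n).+1, forall i,
      m' <= y (l * n)%N i 0 <= m' + q ^+ (l - #|~: N (l * n).+1|)}) ->
    exists m', {in N (l * n).+1, forall i, m' <= y (l.+1 * n)%N i 0
      <= m' + q ^+ (l.+1 - #|~: N (l.+1 * n).+1|)}.
  move=> [m' y_in]; have := anti l; rewrite subEproper mulSn [(n + _)%N]addnC.
  (* Without a crash the exponent grows by at most one, paid by the contraction; with a crash it
     does not grow. *)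
  case/predU1P => [NT|NT].
    have [m'' y_in'] := run_contract yrun NT y_in; exists m'' => i /y_in'.
    case/andP=> -> /le_trans-> //; rewrite NT lerD2l [m' + _]addrC addrK -exprS.
    by apply: ler_wiXn2l => //; lia.
  exists m' => i iN; apply/andP; split.
    by apply: run_ge iN => // j /y_in/andP[].
  have {NT}NT : (#|~: N (l * n).+1| < #|~: N (l * n + n).+1|)%N.
    by apply: proper_card; rewrite properC.
  have y_le : {in N (l * n).+1, forall j,
      - (m' + q ^+ (l - #|~: N (l * n).+1|)) <= (- y (l * n)%N) j 0}.
    by move=> j /y_in/andP[_ ?]; rewrite mxE lerN2.
  have := run_ge n (run_opp yrun) y_le iN; rewrite mxE lerN2 => /le_trans-> //.
  by rewrite lerD2l; apply: ler_wiXn2l => //; lia.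
elim: k => [|k [m' IHk]]; apply: phase; first by exists m => i _; exact: y0.
by exists m' => i iN; apply: IHk (subsetP (anti k) i iN).
Qed.

End Run.

Theorem mainTheorem4 (R : realFieldType) (n f : nat) (E : rel 'I_n)
    (no_loop : irreflexive E)
    (F : {set 'I_n}) (card_F : (#|F| <= f)%N)
    (N : nat -> {set 'I_n}) (rcv : nat -> 'I_n -> {set 'I_n})
    (x : nat -> 'cV[R]_n) (exec : execution E N rcv F x)
    (reduced : forall S : {set 'I_n}, S \subset F ->
       exists2 C : {set 'I_n},
         unique (nontrivial_wcc (reduced_graph E S)) C
         & source (reduced_graph E S) C != set0)
    (removed : trivial_only_removed E F)
    (k : nat) (k_ge1 : (1 <= k)%N) (k_gef : (f <= k)%N) :
  delta N ((k - 1) * n + 1) (Psi R N rcv (k * n) 1)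
    <= (1 - zeta R E ^+ n) ^+ (k - f).
Proof.
case: k k_ge1 k_gef => // k _ _; rewrite subn1 addn1 /=.
have q_ge0 : 0 <= 1 - zeta R E ^+ n by rewrite subr_ge0 zetaX_le1.
have q_le1 : 1 - zeta R E ^+ n <= 1.
  by rewrite gerBl exprn_ge0 // ltW ?zeta_gt0.
(* [0 <= d] accounts for the default value 0 of the maxima. *)
have bigmax_le (D : {set 'I_n}) (g : 'I_n -> R) (d : R) : 0 <= d ->
    {in D, forall i, g i <= d} -> \big[Num.max/0]_(i in D) g i <= d.
  by move=> d_ge0 g_le; elim/big_ind: _ => // u v; rewrite ge_max => -> ->.
have d_ge0 := exprn_ge0 (k.+1 - f) q_ge0.
apply: bigmax_le => // b _; apply: bigmax_le => // a aN.
apply: bigmax_le => // a' a'N.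
pose y t := col b (Psi R N rcv t 1).
(* [Psi R N rcv 0 1] is an empty product, so [y 0] is a column of the identity. *)
have y0 i : 0 <= y 0%N i 0 <= 0 + 1.
  rewrite /y /Psi big_geq // !mxE add0r.
  by case: (_ == _); rewrite ?lexx ?ler01.
have [m y_in] :=
  run_range no_loop exec reduced removed k (run_col_Psi R N rcv b) y0.
have F_le : (#|~: N (k.+1 * n).+1| <= f)%N.
  by apply: leq_trans (subset_leq_card (exec_faulty exec _)) card_F.
have pow_le : (1 - zeta R E ^+ n) ^+ (k.+1 - #|~: N (k.+1 * n).+1|)
    <= (1 - zeta R E ^+ n) ^+ (k.+1 - f).
  by apply: ler_wiXn2l => //; apply: leq_sub2l.
have := y_in a aN; have := y_in a' a'N; rewrite !mxE => /andP[? ?] /andP[? ?].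
by rewrite ler_norml; apply/andP; split; lra.
Qed.
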